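(* Let $n$ be an integer with $n\ge 9$. If $p(n)$ is the number of partitions of $n$ and $a(n)$ is the number of Anosov graphs on $n$ vertices (up to isomorphism), then $p(n)\le a(n)$.
   Context: A partition of $n$ is a nonincreasing tuple of positive integers with sum $n$. A simple graph is a finite undirected graph $G=(V,E)$ without loops or multiple edges. For $x\in V$ let $N(x)=\{y\in V: xy\in E\}$ and $\overline{N}(x)=N(x)\cup\{x\}$. Write $x\sim y$ if $N(x)=N(y)$ or $\overline{N}(x)=\overline{N}(y)$; this is an equivalence relation on $V$. A connected simple graph $G$ is called Anosov if (1) every $\sim$-equivalence class has at least $2$ elements, and (2) every $\sim$-equivalence class with exactly $2$ elements is edgeless, i.e. its two vertices are not adjacent in $G$. *)

(* Defs.v *)
From mathcomp Require Import all_boot all_fingroup.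

Set Implicit Arguments.
Unset Strict Implicit.
Unset Printing Implicit Defensive.

Definition is_partition (n : nat) (s : seq nat) : bool :=
  [&& sorted geq s, all (leq 1) s & sumn s == n].

(* A partition of n has at most n parts, each at most n, so partitions of n
   are counted inside the finite type of bounded sequences over 'I_n.+1;
   is_partition_bseq below shows that none is lost. *)
Definition num_partitions (n : nat) : nat :=
  #|[set t : n.-bseq 'I_n.+1 | is_partition n [seq val i | i <- t]]|.

Lemma is_partition_bseq (n : nat) (s : seq nat) :
  is_partition n s -> exists t : n.-bseq 'I_n.+1, [seq val i | i <- t] = s.
Proof.
case/and3P=> _ s_gt0 /eqP <- {n}.
have size_le : size s <= sumn s.
  elim: s s_gt0 => //= x s IHs /andP[x_gt0 /IHs].
  by rewrite -add1n; apply: leq_add.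
have s_lt x : x \in s -> x < (sumn s).+1.
  rewrite ltnS; elim: {s_gt0 size_le} s => //= y s IHs.
  rewrite inE => /orP[/eqP-> | /IHs le_x]; first exact: leq_addr.
  exact: leq_trans le_x (leq_addl _ _).
have sizeP : size [seq inord x : 'I_(sumn s).+1 | x <- s] <= sumn s.
  by rewrite size_map.
exists (Bseq sizeP); rewrite -map_comp -[RHS]map_id.
by apply/eq_in_map => x /s_lt x_lt /=; rewrite inordK.
Qed.

Section Twins.

Variables (T : finType) (e : rel T).

Definition nbhd (x : T) : {set T} := [set y | e x y].

Definition cnbhd (x : T) : {set T} := x |: nbhd x.

Definition twin : rel T :=
  [rel x y | (nbhd x == nbhd y) || (cnbhd x == cnbhd y)].

Definition twin_classes : {set {set T}} := equivalence_partition twin setT.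

Definition simple_graph : bool :=
  [forall x, ~~ e x x] && [forall x, forall y, e x y == e y x].

Definition connected_graph : bool := [forall x, forall y, connect e x y].

Definition anosov : bool :=
  [&& simple_graph, connected_graph,
      [forall C in twin_classes, 2 <= #|C|] &
      [forall C in twin_classes,
         (#|C| == 2) ==> [forall x in C, forall y in C, ~~ e x y]]].

Lemma twin_equiv : simple_graph -> equivalence_rel twin.
Proof.
case/andP=> /forallP irr /forallP sym.
have symE x y : e x y = e y x by apply/eqP; have /forallP := sym x; apply.
have mix x y z : nbhd x = nbhd y -> cnbhd y = cnbhd z -> x = y \/ y = z.
  move=> Nxy Nyz; have [-> | neq_yz] := eqVneq y z; first by right.
  have yz : e y z.
    by have /setP/(_ z) := Nyz; rewrite !inE eqxx eq_sym (negPf neq_yz).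
  have xz : e x z by have /setP/(_ z) := Nxy; rewrite !inE yz.
  have := Nyz => /setP/(_ x); rewrite !inE [e z x]symE xz orbT.
  case/orP=> [/eqP-> | yx]; first by left.
  by have /setP/(_ x) := Nxy; rewrite !inE yx (negPf (irr x)).
have tsym : symmetric twin.
  by move=> x y; rewrite /twin /= [nbhd x == _]eq_sym [cnbhd x == _]eq_sym.
have ttr : transitive twin.
  move=> y x z; rewrite /twin /= => /orP[] /eqP Hxy /orP[] /eqP Hyz.
  - by rewrite Hxy Hyz eqxx.
  - have [-> | <-] := mix _ _ _ Hxy Hyz; last by rewrite Hxy eqxx.
    by rewrite Hyz eqxx orbT.
  - have [-> | <-] := mix _ _ _ (esym Hyz) (esym Hxy).
      by rewrite Hxy eqxx orbT.
    by rewrite Hyz eqxx.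
  by rewrite Hxy Hyz eqxx orbT.
apply/equivalence_relP; split=> [x | x y xy z]; first by rewrite /twin /= eqxx.
by apply/idP/idP; apply: ttr => //; rewrite tsym.
Qed.

End Twins.

(* A graph on the vertex set T is encoded by its set of ordered adjacent
   pairs, so that the graphs on T form a finite type. *)
Definition adj (T : finType) (E : {set T * T}) : rel T :=
  [rel x y | (x, y) \in E].

Definition graph_iso (T : finType) : rel {set T * T} :=
  [rel E F | [exists s : {perm T},
     forall x, forall y, adj E x y == adj F (s x) (s y)]].

Lemma graph_iso_equiv (T : finType) : equivalence_rel (@graph_iso T).
Proof.
have isoP (E F : {set T * T}) : reflect (exists s : {perm T}, forall x y,
    adj E x y = adj F (s x) (s y)) (graph_iso E F).
  apply: (iffP existsP) => -[s Hs]; exists s.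
    by move=> x y; apply/eqP; have /forallP/(_ x)/forallP := Hs; apply.
  by apply/forallP=> x; apply/forallP=> y; rewrite Hs.
have isym (E F : {set T * T}) : graph_iso E F -> graph_iso F E.
  by case/isoP=> s Hs; apply/isoP; exists (s^-1)%g => x y; rewrite Hs !permKV.
have itr : transitive (@graph_iso T).
  move=> F E G /isoP[s Hs] /isoP[t Ht]; apply/isoP; exists (s * t)%g => x y.
  by rewrite Hs Ht !permM.
apply/equivalence_relP; split=> [E | E F EF G].
  by apply/isoP; exists 1%g => x y; rewrite !perm1.
by apply/idP/idP; apply: itr => //; apply: isym.
Qed.

Definition num_anosov (n : nat) : nat :=
  #|equivalence_partition (@graph_iso 'I_n)
      [set E : {set 'I_n * 'I_n} | anosov (adj E)]|.

(* Main.v *)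
Require Import Defs.
From mathcomp Require Import all_boot all_fingroup zify.

Set Implicit Arguments.
Unset Strict Implicit.
Unset Printing Implicit Defensive.

(** Every partition of n >= 9 is turned into an Anosov graph from which it can
    be read off up to isomorphism.  The graph is a blow-up: every vertex of a
    small class graph is replaced by a clique or by an independent set, and
    these become the twin classes (blowup_twin) as soon as all of them have at
    least two vertices and no two of them have the same kind and the same
    neighbours.  Anosov then means: connected, and all cliques have size at
    least 3 (blowup_anosov).

    Only two shapes of class graph occur: the complete graph, and the complete
    graph with one extra pendant class attached to a single core class.  Split
    a partition into its parts l >= 2 and its m parts equal to 1.  In general:
    - m = 0: the complete multipartite graph on l;
    - m >= 3: the same graph joined to a clique of size m;
    - m = 2: the same graph with a pendant independent class of size 2;
    - m = 1: the largest part, increased by 1, becomes a pendant clique, and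
      the other parts form the complete multipartite core.
    When l has too few parts for this to be connected and free of unwanted
    twins, a path of three classes is used instead: (a,b,1) has one clique end,
    and (a,b,1,1), (a), (a,1), (a,1,1) are marked by two or three clique
    classes.  Making the sizes add up needs n >= 9.

    To tell the graphs apart, attach to each vertex the size of its twin
    class, whether this class is a clique, and whether it is joined to
    everything outside itself.  These features are preserved by isomorphisms,
    so isomorphic blow-ups have the same multiset of class features
    (features_iso).  The function decode computes the partition from that
    multiset (decode_encode), and it depends on the multiset only
    (decode_perm). *)

(** * An isomorphism invariant of vertices *)

Notation profile := (nat * bool * bool)%type.

Definition vertex_feature (T : finType) (e : rel T) (x : T) : profile :=
  (#|[set y | twin e x y]|, [exists y, twin e x y && e x y],
   [forall y, twin e x y || e x y]).

Lemma twin_iso (T : finType) (e f : rel T) (s : {perm T}) :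
  (forall x y, e x y = f (s x) (s y)) ->
  forall x y, twin f (s x) (s y) = twin e x y.
Proof.
move=> ef x y.
have nE z : nbhd f (s z) = s @: nbhd e z.
  apply/setP=> u; rewrite -[u](permKV s) mem_imset; last exact: perm_inj.
  by rewrite !inE -ef.
have cE z : cnbhd f (s z) = s @: cnbhd e z by rewrite /cnbhd nE imsetU1.
by rewrite /twin /= !nE !cE !(inj_eq (imset_inj (@perm_inj _ s))).
Qed.

Lemma vertex_feature_iso (T : finType) (e f : rel T) (s : {perm T}) :
  (forall x y, e x y = f (s x) (s y)) ->
  forall x, vertex_feature f (s x) = vertex_feature e x.
Proof.
move=> ef x; have tE := twin_iso ef.
congr (_, _, _).
- have -> : [set y | twin f (s x) y] = s @: [set y | twin e x y].
    apply/setP=> u; rewrite -[u](permKV s) mem_imset; last exact: perm_inj.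
    by rewrite !in_set tE.
  exact/card_imset/perm_inj.
- apply/existsP/existsP=> -[y xy].
    by exists ((s^-1)%g y); rewrite -tE ef permKV.
  by exists (s y); rewrite tE -ef.
apply/forallP/forallP=> xy y; first by rewrite -tE ef.
by rewrite -[y](permKV s) tE -ef.
Qed.

(** The histogram of vertex features is the only isomorphism invariant that
    the proof compares. *)
Lemma card_feature_iso (T : finType) (e f : rel T) (s : {perm T}) v :
  (forall x y, e x y = f (s x) (s y)) ->
  #|[set x | vertex_feature e x == v]| = #|[set x | vertex_feature f x == v]|.
Proof.
move=> ef; rewrite -(card_imset _ (@perm_inj _ s)); apply: eq_card => u.
rewrite -[u](permKV s) mem_imset; last exact: perm_inj.
by rewrite !inE (vertex_feature_iso ef).
Qed.

(** * Blow-ups of a class graph *)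

Section Blowup.

Variables (T : finType) (I : eqType) (cls : T -> I).
Variables (clique : pred I) (R : rel I).
Variable e : rel T.

Hypothesis eE : forall x y, e x y =
  if cls x == cls y then clique (cls x) && (x != y) else R (cls x) (cls y).
Hypothesis Rsym : symmetric R.
Hypothesis fiber_card : forall x,
  2 + clique (cls x) <= #|[set y | cls x == cls y]|.
(* Two classes would merge into one twin class if they were of the same kind,
   cliques when adjacent and independent when not, and had the same neighbours
   among the other classes. *)
Hypothesis sep : forall x y, cls x != cls y ->
  (if R (cls x) (cls y) then ~~ (clique (cls x) && clique (cls y))
   else clique (cls x) || clique (cls y)) \/
  exists z, [/\ cls z != cls x, cls z != cls y
              & R (cls x) (cls z) != R (cls y) (cls z)].

Lemma blowup_sym x y : e x y = e y x.
Proof.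
rewrite !eE [cls y == _]eq_sym; have [-> | _] := eqVneq; last exact: Rsym.
by rewrite eq_sym.
Qed.

Lemma blowup_simple : simple_graph e.
Proof.
apply/andP; split; apply/forallP=> x; first by rewrite eE !eqxx andbF.
by apply/forallP=> y; rewrite blowup_sym.
Qed.

Lemma fiber_neq x : exists2 y, y != x & cls y = cls x.
Proof.
have /card_gt0P[y] : 0 < #|[set y | cls x == cls y] :\ x|.
  by have := fiber_card x; rewrite (cardsD1 x) inE eqxx; lia.
by rewrite !inE => /andP[yx /eqP]; exists y.
Qed.

(** Twins in different classes c and d contradict sep: a third class cannot
    tell c and d apart, and a second vertex of c or d, which exists because
    classes have at least two vertices, forces c and d to be of the kind that
    sep excludes. *)
Lemma blowup_twin x y : twin e x y = (cls x == cls y).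
Proof.
have outside u v z : cls z != cls u -> cls z != cls v ->
    twin e u v -> R (cls u) (cls z) = R (cls v) (cls z).
  move=> zu zv /orP[] /eqP/setP/(_ z); rewrite !inE !eE.
    by rewrite ![_ == cls z]eq_sym (negPf zu) (negPf zv).
  have -> : (z == u) = false by apply: contraNF zu => /eqP->.
  have -> : (z == v) = false by apply: contraNF zv => /eqP->.
  by rewrite ![_ == cls z]eq_sym (negPf zu) (negPf zv).
apply/idP/idP=> [xy | /eqP xy]; last first.
  have [f_x | nf_x] := boolP (clique (cls x)); apply/orP; [right | left].
    apply/eqP/setP=> z; rewrite !inE !eE -xy f_x ![z == _]eq_sym.
    have [cxz | nxz] := eqVneq (cls x) (cls z); first by rewrite !orbN.
    have -> : (x == z) = false by apply: contraNF nxz => /eqP->.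
    by have -> : (y == z) = false by apply: contraNF nxz => /eqP <-; rewrite xy.
  by apply/eqP/setP=> z; rewrite !inE !eE -xy (negPf nf_x).
apply: contraT => nxy.
have [local | [z [zx zy]]] := sep nxy; last first.
  by rewrite (outside _ _ _ zx zy xy) eqxx.
have nyx : cls y != cls x by rewrite eq_sym.
have neq : x != y by apply: contraNneq nxy => ->.
have [x' x'x cx] := fiber_neq x; have [y' y'y cy] := fiber_neq y.
have x'y : x' != y by apply: contraNneq nxy => <-; rewrite cx.
have y'x : y' != x by apply: contraNneq nyx => <-; rewrite cy.
case/orP: xy => /eqP/setP nE.
- have := nE y; rewrite !inE !eE !eqxx andbF (negPf nxy) => Rxy.
  move: local; rewrite Rxy => /orP[] f.
    have := nE x'; rewrite !inE !eE cx eqxx f eq_sym x'x (negPf nyx).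
    by rewrite Rsym Rxy.
  have := nE y'; rewrite !inE !eE cy eqxx f [y == y']eq_sym y'y (negPf nxy).
  by rewrite Rxy.
have := nE y; rewrite !inE !eE eqxx [y == x]eq_sym (negPf neq) (negPf nxy) /=.
move=> Rxy; move: local; rewrite Rxy negb_and => /orP[] /negPf f.
  have := nE x'; rewrite !inE !eE cx eqxx f (negPf x'x) (negPf nyx).
  by rewrite (negPf x'y) Rsym Rxy.
have := nE y'; rewrite !inE !eE cy eqxx f (negPf y'y) (negPf nxy).
by rewrite (negPf y'x) Rxy.
Qed.

Lemma blowup_twin_class x :
  [set y | twin e x y] = [set y | cls x == cls y].
Proof. by apply/setP=> y; rewrite !in_set blowup_twin. Qed.

Lemma blowup_anosov : connected_graph e -> anosov e.
Proof.
move=> conn; rewrite /anosov blowup_simple conn /=.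
have twE x : [set y in setT | twin e x y] = [set y | cls x == cls y].
  by rewrite -blowup_twin_class; apply/setP=> y; rewrite !inE.
apply/andP; split; apply/forallP=> C; apply/implyP=> /imsetP[x _ ->];
  rewrite twE.
  exact: leq_trans (leq_addr _ _) (fiber_card x).
apply/implyP=> /eqP card2; apply/forallP=> y.
apply/implyP; rewrite inE => /eqP xy.
apply/forallP=> z; apply/implyP; rewrite inE eE -xy => xz.
by have := fiber_card x; rewrite card2 xz; case: clique.
Qed.

Lemma blowup_vertex_feature x : vertex_feature e x =
  (#|[set y | cls x == cls y]|, clique (cls x),
   [forall y, (cls x == cls y) || R (cls x) (cls y)]).
Proof.
congr (_, _, _).
- by rewrite blowup_twin_class.
- apply/existsP/idP => [[y]|flx].
    by rewrite blowup_twin eE => /andP[->] /andP[].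
  have [y yx cy] := fiber_neq x.
  by exists y; rewrite blowup_twin eE cy eqxx flx eq_sym.
by apply: eq_forallb => y; rewrite blowup_twin eE; case: eqP.
Qed.

(** A class joined to everything else connects the graph through a vertex b
    outside that class. *)
Lemma blowup_connected c :
  (forall x, cls x != c -> R (cls x) c) -> (exists x, cls x == c) ->
  (exists x, cls x != c) -> connected_graph e.
Proof.
move=> Rc [a /eqP ca] [b cb].
have e_in x y : cls x != c -> cls y = c -> e x y.
  by move=> cx cy; rewrite eE cy (negPf cx) Rc.
have sym : connect_sym e by apply: sym_connect_sym => x y; exact: blowup_sym.
have to_a x : connect e x a.
  have [cx | ncx] := eqVneq (cls x) c; last exact/connect1/e_in.
  apply: (@connect_trans _ _ b); last exact/connect1/e_in.
  by rewrite sym; exact/connect1/e_in.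
apply/forallP=> x; apply/forallP=> y.
by apply: connect_trans (to_a x) _; rewrite sym.
Qed.

End Blowup.

(** * Blow-ups given by a list of classes *)

(** The size of a twin class and whether it is a clique. *)
Notation vclass := (nat * bool)%type.

(** The classes of the vertices 0, 1, 2 and so on: class j fills a block whose
    length is the size of class j. *)
Definition class_word (s : seq vclass) : seq nat :=
  flatten [seq nseq (nth (0, false) s j).1 j | j <- iota 0 (size s)].

Lemma count_word (s : seq vclass) (P : pred nat) :
  count P (class_word s) =
  sumn [seq P j * (nth (0, false) s j).1 | j <- iota 0 (size s)].
Proof.
rewrite /class_word; elim: (iota _ _) => //= j r IHr.
by rewrite count_cat count_nseq IHr.
Qed.

Lemma size_word (s : seq vclass) : size (class_word s) = sumn (unzip1 s).
Proof.
rewrite -count_predT count_word; congr sumn; rewrite -[RHS](mkseq_nth 0).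
rewrite /mkseq size_map; apply/eq_in_map=> j; rewrite mem_iota => /andP[_ js].
by rewrite mul1n (nth_map (0, false)).
Qed.

Lemma count_mem_word (s : seq vclass) j :
  count_mem j (class_word s) = (nth (0, false) s j).1.
Proof.
rewrite count_word.
(* The default class has size 0, so the formula also holds beyond the list. *)
have -> : (nth (0, false) s j).1 =
          (j \in iota 0 (size s)) * (nth (0, false) s j).1.
  rewrite mem_iota /= add0n.
  by case: ltnP => [_|/(nth_default (0, false))->]; rewrite ?mul1n.
elim: (iota 0 _) (iota_uniq 0 (size s)) => //= i r IHr /andP[ir /IHr->].
rewrite in_cons eq_sym; case: eqVneq => [-> | _] //=.
by rewrite (negPf ir) addn0.
Qed.

Lemma mem_word (s : seq vclass) j :
  (j \in class_word s) = (0 < (nth (0, false) s j).1).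
Proof. by rewrite -count_mem_word -has_count has_pred1. Qed.

Lemma card_nth (n : nat) (w : seq nat) (P : pred nat) : size w = n ->
  #|[set i : 'I_n | P (nth 0 w i)]| = count P w.
Proof.
move=> <-; rewrite -[w in RHS]/(tval (in_tuple w)).
rewrite -[in RHS](map_tnth_enum (in_tuple w)) count_map enumT.
rewrite cardsE cardE /enum_mem size_filter; apply: eq_count => i.
by rewrite /= (tnth_nth 0).
Qed.

(** Without pend this is the complete graph; with pend, class 0 is pendant,
    attached to class 1, and the classes from 1 on are pairwise adjacent. *)
Definition class_rel (pend : bool) : rel nat := fun i j =>
  (i != j) &&
  (pend ==> ((0 < i) || (j == 1)) && ((0 < j) || (i == 1))).

Definition fully_joined (pend : bool) (i : nat) : bool := ~~ pend || (i == 1).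

Definition feature (pend : bool) (s : seq vclass) (i : nat) : profile :=
  (nth (0, false) s i, fully_joined pend i).

Definition features (pend : bool) (s : seq vclass) : seq profile :=
  [seq feature pend s i | i <- iota 0 (size s)].

(** Two adjacent clique classes merge unless the pendant class 0 is attached to
    exactly one of them.  So at most one class of a complete class graph may be
    a clique, by convention the first; in a core with a pendant class, class 1
    and one further class may be, by convention class 2.  In a path of
    three classes the two ends have the same neighbours and must not both be
    independent. *)
Definition valid (pend : bool) (s : seq vclass) : bool :=
  [&& all (fun c : vclass => 2 + c.2 <= c.1) s,
      ~~ has snd (drop (if pend then 3 else 1) s) &
      let flag i := (nth (0, false) s i).2 in
      if pend then (3 < size s) || (size s == 3) && (flag 0 || flag 2)
      else (1 < size s) || (size s == 1) && flag 0].

Section CodeGraph.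

Variables (n : nat) (pend : bool) (s : seq vclass).

Definition vertex_class (i : 'I_n) : nat := nth 0 (class_word s) i.

Definition code_graph : {set 'I_n * 'I_n} :=
  [set p | if vertex_class p.1 == vertex_class p.2
           then (nth (0, false) s (vertex_class p.1)).2 && (p.1 != p.2)
           else class_rel pend (vertex_class p.1) (vertex_class p.2)].

Hypotheses (s_valid : valid pend s) (w_size : size (class_word s) = n).

Let flag i := (nth (0, false) s i).2.

Lemma code_graphE i j : adj code_graph i j =
  if vertex_class i == vertex_class j then flag (vertex_class i) && (i != j)
  else class_rel pend (vertex_class i) (vertex_class j).
Proof. by rewrite /adj /= inE. Qed.

Lemma class_rel_sym : symmetric (class_rel pend).
Proof. by move=> i j; rewrite /class_rel eq_sym [X in _ ==> X]andbC. Qed.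

Lemma card_vertex_class (P : pred nat) :
  #|[set i | P (vertex_class i)]| = count P (class_word s).
Proof. exact: card_nth. Qed.

Lemma class_pos j : (j < size s) = (0 < (nth (0, false) s j).1).
Proof.
have [js | sj] := ltnP; last by rewrite nth_default.
by case/and3P: s_valid => /(all_nthP (0, false))/(_ j js) /(leq_trans _)->.
Qed.

Lemma vertex_class_lt i : vertex_class i < size s.
Proof. by rewrite class_pos -mem_word mem_nth ?w_size. Qed.

Lemma vertex_class_ex j : j < size s -> exists i, vertex_class i = j.
Proof.
rewrite class_pos -mem_word => /(nthP 0)[i]; rewrite w_size => i_n <-.
by exists (Ordinal i_n).
Qed.

Lemma card_fiber i :
  #|[set j | vertex_class i == vertex_class j]| =
  (nth (0, false) s (vertex_class i)).1.
Proof.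
rewrite -count_mem_word -card_vertex_class; apply: eq_card => j.
by rewrite !inE eq_sym.
Qed.

Lemma fiber_card_code i :
  2 + flag (vertex_class i) <= #|[set j | vertex_class i == vertex_class j]|.
Proof.
rewrite card_fiber; case/and3P: s_valid => /(all_nthP (0, false)) sz _ _.
exact/sz/vertex_class_lt.
Qed.

Lemma flag_late i : (if pend then 3 else 1) <= i -> flag i = false.
Proof.
case/and3P: s_valid => _ no_flag _ le_i; apply: contraNF no_flag => fi.
have i_s : i < size s.
  by rewrite ltnNge; apply: contraL fi => sz; rewrite /flag nth_default.
apply/(has_nthP (0, false)); exists (i - (if pend then 3 else 1)).
  by rewrite size_drop ltn_sub2r // (leq_ltn_trans le_i).
by rewrite nth_drop subnKC.
Qed.

(** The pendant class separates class 1 from the other core classes; two core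
    classes beyond it are adjacent and not both cliques; class 0 is separated
    from a core class by a second core class, if there is one. *)
Lemma code_sep i j : i != j -> i < size s -> j < size s ->
  (if class_rel pend i j then ~~ (flag i && flag j) else flag i || flag j) \/
  exists k, [/\ k < size s, k != i, k != j
              & class_rel pend i k != class_rel pend j k].
Proof.
wlog: i j / i < j => [IH ne_ij i_s j_s|].
  have [lt_ij | lt_ji | eq_ij] := ltngtP i j; first exact: IH.
    have [] := IH j i lt_ji _ j_s i_s; first by rewrite eq_sym.
      by rewrite class_rel_sym andbC orbC; left.
    by case=> k [ks kj ki Rk]; right; exists k; split; rewrite // eq_sym.
  by rewrite eq_ij eqxx in ne_ij.
move=> lt_ij _ i_s j_s.
case/and3P: s_valid => _ _; rewrite -/(flag 0) -/(flag 2) /class_rel.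
have := flag_late; case: (pend) => /= late sz.
  case: i lt_ij i_s => [|i] lt_ij i_s; last first.
    case: i lt_ij i_s => [|i] lt_ij i_s.
      right; exists 0; split=> //; first lia.
        by case: j lt_ij {j_s} => [|[|j]].
      by case: j lt_ij {j_s} => [|[|j]].
    left; have -> : flag j = false by apply: late; lia.
    by rewrite andbF; case: ifP => //; lia.
  have s3 : 2 < size s by case/orP: sz => [/ltnW|/andP[/eqP->]].
  case: j lt_ij j_s => [|[|j]] // _ j_s; first by right; exists 2.
  case/orP: sz => [s4 | /andP[/eqP s3' f02]].
    right; exists (if j == 0 then 3 else 2); case: j j_s => [|j] //; split=> //.
  left=> /=; case: j j_s => [|j] //; lia.
left; have -> : flag j = false by apply: late; lia.
by rewrite andbF; case: ifP => //; lia.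
Qed.

Lemma vertex_sep i j : vertex_class i != vertex_class j ->
  let c := vertex_class i in let d := vertex_class j in
  (if class_rel pend c d then ~~ (flag c && flag d) else flag c || flag d) \/
  exists k, [/\ vertex_class k != c, vertex_class k != d
              & class_rel pend c (vertex_class k) !=
                class_rel pend d (vertex_class k)].
Proof.
move=> ne_ij /=.
have := code_sep ne_ij (vertex_class_lt i) (vertex_class_lt j).
case=> [|[k [k_s ki kj Rk]]]; first by left.
by have [z zk] := vertex_class_ex k_s; right; exists z; rewrite zk.
Qed.

Lemma code_connected : connected_graph (adj code_graph).
Proof.
have [s1 | ] := ltnP 1 (size s).
  have [x x1] := vertex_class_ex s1; have [y y0] := vertex_class_ex (ltnW s1).
  apply: (blowup_connected code_graphE class_rel_sym (c := 1)).
  - by move=> z z1; rewrite /class_rel z1 orbT implybT.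
  - by exists x; rewrite x1.
  by exists y; rewrite y0.
move=> s1; apply/forallP=> x; apply/forallP=> y.
have [-> | ne_xy] := eqVneq x y; first exact: connect0.
have cls0 z : vertex_class z = 0 by have := vertex_class_lt z; lia.
apply: connect1; rewrite code_graphE !cls0 /= ne_xy andbT.
case/and3P: s_valid => _ _; rewrite -/(flag 0).
by case: pend s1 => s1; [move: s1; lia | case/orP=> [|/andP[]//]; lia].
Qed.

Lemma code_anosov : anosov (adj code_graph).
Proof.
exact: blowup_anosov code_graphE class_rel_sym fiber_card_code vertex_sep
  code_connected.
Qed.

Lemma code_vertex_feature x :
  vertex_feature (adj code_graph) x = feature pend s (vertex_class x).
Proof.
have -> := blowup_vertex_feature code_graphE class_rel_sym fiber_card_code
  vertex_sep.
rewrite card_fiber /feature [nth _ _ _]surjective_pairing; congr (_, _).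
rewrite /fully_joined; have [c1 | nc1] := eqVneq (vertex_class x) 1.
  rewrite orbT c1; apply/forallP=> y; rewrite /class_rel.
  by case: eqP => //=; rewrite orbT implybT.
rewrite orbF; case/and3P: s_valid => _ _; rewrite /class_rel.
case: (pend) => /= sz; last first.
  by apply/forallP=> y; rewrite andbT orbN.
have s3 : 2 < size s by case/orP: sz => [/ltnW|/andP[/eqP->]].
apply/negbTE/forallPn.
(* The pendant class is not adjacent to class 2, nor to any later class. *)
pose j := if vertex_class x == 0 then 2 else 0.
have [y yE] : exists y, vertex_class y = j.
  by apply: vertex_class_ex; rewrite /j; case: ifP; lia.
by exists y; rewrite yE /j; case: (vertex_class x) nc1 => [|[|c]].
Qed.

(** A class with feature v contributes as many vertices as the size recorded
    in v, so the histogram of vertices determines that of classes. *)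
Lemma card_code_feature v :
  #|[set x | vertex_feature (adj code_graph) x == v]| =
  v.1.1 * count_mem v (features pend s).
Proof.
rewrite (eq_card (B := [set x | feature pend s (vertex_class x) == v])).
  rewrite (card_vertex_class (fun j => feature pend s j == v)) count_word.
  rewrite /features; elim: (iota _ _) => [|j r IHr] /=; first by rewrite muln0.
  by rewrite IHr mulnDr; case: eqP => [<-|]; rewrite ?muln0 ?muln1 ?mul1n.
by move=> x; rewrite !inE code_vertex_feature.
Qed.

End CodeGraph.

Lemma features_ge2 pend s v :
  valid pend s -> v \in features pend s -> 1 < v.1.1.
Proof.
case/and3P=> /(all_nthP (0, false)) sz _ _ /mapP[i].
rewrite mem_iota => /andP[_ i_s] ->.
exact: leq_trans (leq_addr _ _) (sz i i_s).
Qed.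

Lemma features_iso n p1 s1 p2 s2 (v1 : valid p1 s1) (v2 : valid p2 s2)
    (w1 : size (class_word s1) = n) (w2 : size (class_word s2) = n) :
  graph_iso (code_graph n p1 s1) (code_graph n p2 s2) ->
  perm_eq (features p1 s1) (features p2 s2).
Proof.
case/existsP=> s /forallP iso.
have isoE x y :
    adj (code_graph n p1 s1) x y = adj (code_graph n p2 s2) (s x) (s y).
  by apply/eqP; have /forallP := iso x; apply.
apply/allP=> v; rewrite mem_cat => v_in /=.
have v_gt0 : 0 < v.1.1.
  apply: ltnW.
  by case/orP: v_in; [exact: features_ge2 v1 | exact: features_ge2 v2].
rewrite -(eqn_pmul2l v_gt0) -(card_code_feature v1 w1).
by rewrite -(card_code_feature v2 w2) (card_feature_iso v isoE).
Qed.

Lemma features_complete s : features false s = [seq (c, true) | c <- s].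
Proof.
rewrite -[s in RHS](mkseq_nth (0, false)) /mkseq -map_comp.
exact: eq_map.
Qed.

Lemma features_pendant c0 c1 s :
  features true [:: c0, c1 & s] =
  [:: (c0, false), (c1, true) & [seq (c, false) | c <- s]].
Proof.
rewrite /features /= -[s in RHS](mkseq_nth (0, false)) /mkseq -map_comp.
by rewrite (iotaDl 2 0) -map_comp.
Qed.

(** * Encoding a partition *)

Definition independent (l : seq nat) : seq vclass := [seq (a, false) | a <- l].

(** The arguments are the parts l >= 2, in nonincreasing order, and the number
    m of parts equal to 1.  The short lists l for which the general scheme
    fails go to paths with 3 classes.  For (a,b,1) the clique end is not the
    largest class, since the other two sizes add up to n - 3 >= 6, whereas in
    the general scheme for m = 1 the pendant clique is the strictly largest
    class.  For (a,b,1,1) the size 2 of the independent end distinguishes the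
    path from that of (a,1,1), and a >= 4 makes a - 1 a legal clique size. *)
Definition encode (l : seq nat) (m : nat) : bool * seq vclass :=
  match m, l with
  | 0, [:: a] => (true, [:: (3, true); (a - 6, false); (3, true)])
  | 0, _ => (false, independent l)
  | 1, [:: a] => (true, [:: (3, true); (a - 5, true); (3, true)])
  | 1, [:: a; b] => (true, [:: (b, false); (a - 2, false); (3, true)])
  | 1, a :: l' => (true, (a.+1, true) :: independent l')
  | 2, [:: a] => (true, [:: (3, false); (3, true); (a - 4, true)])
  | 2, [:: a; b] => (true, [:: (2, false); (b.+1, true); (a.-1, true)])
  | 2, _ => (true, (2, false) :: independent l)
  | _, _ => (false, (m, true) :: independent l)
  end.

Definition clique_sizes (S : seq profile) : seq nat :=
  [seq v.1.1 | v <- S & v.1.2].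

Definition indep_sizes (S : seq profile) : seq nat :=
  [seq v.1.1 | v <- S & ~~ v.1.2].

(** The branches undo the cases of encode: all classes are joined to each other
    for the complete class graphs, and otherwise there is no clique for the
    general case of m = 2 and three of them for (a,1).  With one clique, its
    being strictly larger than the other classes tells the general case of
    m = 1 from the paths of (a,b,1).  With two, the kind of the middle class
    and the size of the independent end tell the remaining paths apart. *)
Definition decode (S : seq profile) : seq nat :=
  let k := sumn (clique_sizes S) in
  if all snd S then indep_sizes S ++ nseq k 1 else
  match size (clique_sizes S) with
  | 0 => rem 2 (indep_sizes S) ++ [:: 1; 1]
  | 1 => if all (ltn^~ k) (indep_sizes S) then k.-1 :: indep_sizes S ++ [:: 1]
         else [seq v.1.1 + 2 * v.2 | v : profile <- S & ~~ v.1.2] ++ [:: 1]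
  | 2 => let n := sumn [seq v.1.1 | v <- S] in
         if has (fun v : profile => ~~ v.1.2 && v.2) S then [:: n]
         else if 2 \in indep_sizes S then
           [seq (if v.2 then v.1.1.-1 else v.1.1.+1)
              | v : profile <- S & v.1.2] ++ [:: 1; 1]
         else [:: n - 2; 1; 1]
  | _ => [:: (sumn [seq v.1.1 | v <- S]).-1; 1]
  end.

Lemma decode_perm S1 S2 : perm_eq S1 S2 -> perm_eq (decode S1) (decode S2).
Proof.
move=> S12.
have pm (f : profile -> nat) P :
    perm_eq [seq f v | v <- S1 & P v] [seq f v | v <- S2 & P v].
  exact/perm_map/perm_filter.
have kE : perm_eq (clique_sizes S1) (clique_sizes S2) by exact: pm.
have iE : perm_eq (indep_sizes S1) (indep_sizes S2) by exact: pm.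
have nE : sumn [seq v.1.1 | v <- S1] = sumn [seq v.1.1 | v <- S2].
  exact/perm_sumn/perm_map.
rewrite /decode nE (perm_sumn kE) (perm_size kE).
rewrite (perm_all _ S12) (perm_has _ S12) (perm_all _ iE) (perm_mem iE).
case: ifP => _; first by rewrite perm_cat2r.
case: (size _) => [|[|[|k]]] //.
- rewrite perm_cat2r; apply/seq.permP=> P.
  by rewrite !count_rem (perm_mem iE) (seq.permP iE).
- by case: ifP => _; rewrite ?perm_cons perm_cat2r ?pm.
by do 2?case: ifP => _ //; rewrite perm_cat2r pm.
Qed.

Lemma clique_sizes_indep b l :
  clique_sizes [seq (c, b) | c <- independent l] = [::].
Proof. by elim: l. Qed.

Lemma indep_sizes_indep b l :
  indep_sizes [seq (c, b) | c <- independent l] = l.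
Proof. by elim: l => //= a l {2}<-. Qed.

Lemma clique_sizes_cons v S :
  clique_sizes (v :: S) = nseq v.1.2 v.1.1 ++ clique_sizes S.
Proof. by rewrite /clique_sizes /=; case: v.1.2. Qed.

Lemma indep_sizes_cons v S :
  indep_sizes (v :: S) = nseq (~~ v.1.2) v.1.1 ++ indep_sizes S.
Proof. by rewrite /indep_sizes /=; case: v.1.2. Qed.

Lemma decode_complete l : decode (features false (independent l)) = l.
Proof.
rewrite features_complete /decode clique_sizes_indep indep_sizes_indep.
by rewrite all_map (eq_all (a2 := predT)) // all_predT cats0.
Qed.

Lemma decode_complete_clique k l :
  decode (features false ((k, true) :: independent l)) = l ++ nseq k 1.
Proof.
rewrite features_complete /decode all_map (eq_all (a2 := predT)) // all_predT.
rewrite map_cons clique_sizes_cons indep_sizes_cons.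
by rewrite clique_sizes_indep indep_sizes_indep /= addn0.
Qed.

Lemma decode_pendant_indep a l :
  decode (features true ((2, false) :: independent (a :: l))) =
  a :: l ++ [:: 1; 1].
Proof.
rewrite features_pendant /decode !clique_sizes_cons !indep_sizes_cons.
by rewrite clique_sizes_indep indep_sizes_indep.
Qed.

Lemma decode_pendant_clique k a l : all (ltn^~ k) (a :: l) ->
  decode (features true ((k, true) :: independent (a :: l))) =
  k.-1 :: a :: l ++ [:: 1].
Proof.
move=> lt_k; rewrite features_pendant /decode.
rewrite !clique_sizes_cons !indep_sizes_cons.
rewrite clique_sizes_indep indep_sizes_indep /= addn0.
by rewrite -/(all _ (a :: l)) lt_k.
Qed.

Section Encode.

Variables (n m : nat) (l : seq nat).
Hypotheses (n_ge9 : 9 <= n) (l_ge2 : all (leq 2) l) (l_sorted : sorted geq l).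
Hypothesis lm_n : sumn l + m = n.

Lemma encode_size : size (class_word (encode l m).2) = n.
Proof.
have indE r : unzip1 (independent r) = r by rewrite /unzip1 -map_comp map_id.
rewrite size_word; move: lm_n l_sorted l_ge2.
case: m => [|[|[|k]]]; case: l => [|a [|b [|c r]]] /=; rewrite ?indE /=; lia.
Qed.

Lemma encode_valid : valid (encode l m).1 (encode l m).2.
Proof.
have indE r :
    all (fun c : vclass => 2 + c.2 <= c.1) (independent r) = all (leq 2) r.
  by rewrite all_map; apply: eq_all => a /=; rewrite addn0.
have flE r j : has snd (drop j (independent r)) = false.
  by rewrite -map_drop has_map; elim: (drop _ _).
have flE0 r : has snd (independent r) = false.
  by rewrite -(drop0 (_ r)) flE.
move: lm_n l_sorted l_ge2.
case: m => [|[|[|k]]]; case: l => [|a [|b [|c r]]];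
  rewrite /valid /= ?indE ?drop0 ?flE ?flE0 ?size_map;
  rewrite ?orbT ?andbT ?andbF /=; lia.
Qed.

Lemma decode_encode :
  perm_eq (decode (features (encode l m).1 (encode l m).2)) (l ++ nseq m 1).
Proof.
move: lm_n l_sorted l_ge2.
case: m => [|[|[|k]]]; case: l => [|a [|b [|c r]]];
  cbn [encode fst snd] => sum_n sorted_l ge2_l.
- by move: sum_n => /=; lia.
- rewrite (_ : decode _ = [:: a]) //; congr [:: _] => /=.
  by move: sum_n => /=; lia.
- by rewrite decode_complete cats0.
- by rewrite decode_complete cats0.
- by move: sum_n => /=; lia.
- rewrite (_ : decode _ = [:: a; 1]) //; congr [:: _; _] => /=.
  by move: sum_n => /=; lia.
- have not_max : all (ltn^~ 3) [:: b; a - 2] = false.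
    by move: sum_n => /=; lia.
  have -> : decode (features true [:: (b, false); (a - 2, false); (3, true)]) =
            [:: b; a; 1].
    have a_ge2 : a - 2 + 2 = a by move: sum_n sorted_l => /=; lia.
    rewrite /decode /= -[X in if X then _ else _]/(all (ltn^~ 3) [:: b; a - 2]).
    by rewrite not_max addn0 a_ge2.
  by rewrite (perm_catCA [:: b] [:: a] [:: 1]).
- have lt_a : all (ltn^~ a.+1) [:: b, c & r].
    apply/allP=> x x_in; rewrite /= ltnS.
    have /allP := order_path_min (rev_trans leq_trans) sorted_l; exact.
  by rewrite decode_pendant_clique.
- by move: sum_n => /=; lia.
- rewrite (_ : decode _ = [:: a; 1; 1]) //; congr [:: _; _; _] => /=.
  by move: sum_n => /=; lia.
- have a_gt0 : a.-1.+1 = a by move: sum_n sorted_l => /=; lia.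
  by rewrite /decode /= a_gt0 (perm_catCA [:: b] [:: a] [:: 1; 1]).
- by rewrite decode_pendant_indep.
- by rewrite decode_complete_clique.
- by rewrite decode_complete_clique.
- by rewrite decode_complete_clique.
by rewrite decode_complete_clique.
Qed.

End Encode.

(** * Partitions inject into Anosov graphs *)

Definition partition_graph (n : nat) (p : seq nat) : {set 'I_n * 'I_n} :=
  let c := encode [seq x <- p | 1 < x] (count_mem 1 p) in
  code_graph n c.1 c.2.

Lemma split_ones p : all (leq 1) p ->
  perm_eq ([seq x <- p | 1 < x] ++ nseq (count_mem 1 p) 1) p.
Proof.
move=> /allP p_gt0.
rewrite perm_sym -(perm_filterC (ltn 1) p) perm_cat2l perm_sym.
rewrite -size_filter.
have -> : filter (predC (ltn 1)) p = filter (pred1 1) p.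
  by apply: eq_in_filter => x /p_gt0 /=; lia.
by have /all_pred1P <- := filter_all (pred1 1) p.
Qed.

Section PartitionGraph.

Variables (n : nat) (n_ge9 : 9 <= n).

Lemma partition_code p : is_partition n p ->
  let c := encode [seq x <- p | 1 < x] (count_mem 1 p) in
  [/\ valid c.1 c.2, size (class_word c.2) = n
    & perm_eq (decode (features c.1 c.2)) p].
Proof.
case/and3P=> sorted_p p_gt0 /eqP sum_p; have p_split := split_ones p_gt0.
set l := filter _ _; set m := count_mem 1 p.
have l_ge2 : all (leq 2) l by exact: filter_all.
have l_sorted : sorted geq l.
  by apply: sorted_filter => //; exact: rev_trans leq_trans.
have lm_n : sumn l + m = n.
  by rewrite -sum_p -(perm_sumn p_split) sumn_cat sumn_nseq mul1n.
split; [exact: encode_valid lm_n | exact: encode_size lm_n |].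
exact: perm_trans (decode_encode n_ge9 _ _ lm_n) p_split.
Qed.

Lemma partition_graph_anosov p :
  is_partition n p -> anosov (adj (partition_graph n p)).
Proof. by case/partition_code=> v w _; exact: code_anosov. Qed.

Lemma partition_graph_inj p q : is_partition n p -> is_partition n q ->
  graph_iso (partition_graph n p) (partition_graph n q) -> p = q.
Proof.
move=> pP qP.
have [vp wp dp] := partition_code pP.
have [vq wq dq] := partition_code qP.
move=> /(features_iso vp vq wp wq)/decode_perm dpq.
apply: (@sorted_eq _ geq).
- exact: rev_trans leq_trans.
- by move=> x y /= xy; apply/eqP; rewrite eqn_leq andbC.
- by case/and3P: pP.
- by case/and3P: qP.
by rewrite -(permPl dp) (permPl dpq).
Qed.

End PartitionGraph.

Theorem theorem6p1 (n : nat) (hn : 9 <= n) : num_partitions n <= num_anosov n.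
Proof.
pose parts (t : n.-bseq 'I_n.+1) := [seq val i | i <- t].
pose D := [set E : {set 'I_n * 'I_n} | anosov (adj E)].
pose iso_class t := [set F in D | graph_iso (partition_graph n (parts t)) F].
have graph_D t : is_partition n (parts t) -> partition_graph n (parts t) \in D.
  by rewrite inE; exact: partition_graph_anosov.
have /equivalence_relP[iso_refl _] := @graph_iso_equiv 'I_n.
rewrite /num_partitions -(card_in_imset (f := iso_class)).
  apply/subset_leq_card/subsetP=> C /imsetP[t]; rewrite inE => tP ->.
  exact/imset_f/graph_D.
move=> t u; rewrite !inE => tP uP /setP/(_ (partition_graph n (parts u))).
rewrite [LHS]in_set [RHS]in_set graph_D // iso_refl.
move=> /(partition_graph_inj hn tP uP)/(inj_map val_inj) tu.
exact/val_inj.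
Qed.
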